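(* Generalised Koornwinder polynomials $H_{n,k}(x,y)=p_{n-k,k}(x)\,\rho(x)^k\,q_k(y/\rho(x))$, $0\le k\le n$, $n\in\mathbb N_0$, have the following properties. (i) They are mutually orthogonal, i.e. $\langle H_{n,k},H_{m,\ell}\rangle_W=\delta_{n,m}\,\delta_{k,\ell}\,\|H_{n,k}\|_W^2$ (here $\delta_{n,m},\delta_{k,\ell}$ are Kronecker deltas). (ii) In case (i), there exist constants $c_0,\dots,c_k$ such that $$H_{n,k}=c_0x^{n-k}\rho^k+c_1x^{n-k}\rho^{k-1}y+\cdots+c_kx^{n-k}y^k+\mathcal O\left(x^{\ell_1}\rho^{\ell_2}y^{\ell_3}\right),\qquad \ell_1+\ell_2+\ell_3<n,$$ where $0\le\ell_3\le k-1$, and there are constants $c_{m,\ell}$ such that $$x^{n-k}y^k=\sum_{\ell=0}^{k}\;\sum_{m=\ell}^{n+(k-\ell)(d_0-1)}c_{m,\ell}\,H_{m,\ell},\qquad 0\le k\le n.$$ In case (ii), if $k$ is even, there are constants $c_0,c_2,\dots,c_k$ such that $$H_{n,k}=c_0x^{n-k}\rho^k+c_2x^{n-k}\rho^{k-2}y^2+\cdots+c_kx^{n-k}y^k+\mathcal O\left(x^{\ell_1}\rho^{\ell_2}y^{\ell_3}\right),\qquad \ell_1+\ell_2+\ell_3<n,$$ where $\ell_3$ is even and $0\le\ell_3\le k-2$; if $k$ is odd, there are constants $c_1,c_3,\dots,c_k$ such that $$H_{n,k}=c_1x^{n-k}\rho^{k-1}y+c_3x^{n-k}\rho^{k-3}y^3+\cdots+c_kx^{n-k}y^k+\mathcal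 O\left(x^{\ell_1}\rho^{\ell_2}y^{\ell_3}\right),\qquad \ell_1+\ell_2+\ell_3<n,$$ where $\ell_3$ is odd and $1\le\ell_3\le k-2$. In case (ii), there are constants $c_{m,\ell}$ such that $$x^{n-k}y^k=\sum_{\substack{\ell=0\\ \ell\equiv k\ (\mathrm{mod}\ 2)}}^{k}\;\sum_{m=\ell}^{n+(k-\ell)(d_1-2)/2}c_{m,\ell}\,H_{m,\ell},\qquad 0\le k\le n.$$
   Context: Let $w_1$ and $w_2$ be weight functions on the intervals $[\alpha,\beta]$ and $[\gamma,\delta]$ respectively. Let $\rho$ be a function that is positive on $(\alpha,\beta)$, where one of the following holds. Case (i): $\rho$ is a polynomial, with $\deg\rho=:d_0$ (no restriction on the degree). Case (ii): $\rho$ is the square root of a polynomial, with $\deg\rho^2=:d_1$ (no restriction on the degree), $\delta=-\gamma>0$, and $w_2$ is an even function. For $k,n\in\mathbb N_0=\{0,1,2,\dots\}$ let $p_{n,k}$ be a univariate orthogonal polynomial of degree $n$ with respect to the weight $\rho(x)^{2k+1}w_1(x)$ on $[\alpha,\beta]$ (so that $p_{0,k},p_{1,k},\dots$ are mutually orthogonal for this weight), and let $q_n$ be a univariate orthogonal polynomial of degree $n$ with respect to $w_2$ on $[\gamma,\delta]$. The functions $H_{n,k}(x,y):=p_{n-k,k}(x)\rho(x)^kq_k(y/\rho(x))$, $0\le k\le n$, are called generalised Koornwinder polynomials. Set $\Omega:=\{(x,y):\gamma\rho(x)\le y\le\delta\rho(x),\ \alpha\le x\le\beta\}$, $W(x,y):=w_1(x)w_2(y/\rho(x))$,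 $\langle f,g\rangle_W:=\iint_\Omega f(x,y)g(x,y)W(x,y)\,\mathrm dx\,\mathrm dy$ and $\|f\|_W:=\sqrt{\langle f,f\rangle_W}$. The notation $\mathcal O(x^{\ell_1}\rho^{\ell_2}y^{\ell_3})$ stands for the remaining lower-order terms, i.e. a finite linear combination of terms $x^{\ell_1}\rho^{\ell_2}y^{\ell_3}$ with nonnegative integer exponents subject to the stated constraints.
   Formalization: In the remainder terms of the expansions of H_{n,k}, the upper bounds ℓ_3 ≤ k−1 (case (i)) and ℓ_3 ≤ k−2 (case (ii)) are replaced by ℓ_3 ≤ k, since as printed they fail, e.g. for H_{1,0} = x − 1/2 with ρ = 1, w_1 = 1 on [0,1]. *)

(* Defs.v *)
From HB Require Import structures.
From mathcomp Require Import all_boot all_order all_algebra.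
From mathcomp Require Import all_classical all_reals all_analysis.

Set Implicit Arguments.
Unset Strict Implicit.
Unset Printing Implicit Defensive.

Import Order.TTheory GRing.Theory Num.Theory.
Import numFieldNormedType.Exports.

Local Open Scope classical_set_scope.
Local Open Scope ring_scope.

(* On a bounded interval, integrability of w makes all of its moments finite. *)
Definition weight_on (R : realType) (a b : R) (w : R -> R) : Prop :=
  [/\ (forall x, a < x < b -> 0 <= w x),
      lebesgue_measure.-integrable `[a, b] (EFin \o w) &
      0 < \int[lebesgue_measure]_(x in `[a, b]) w x].

(* No normalisation is imposed: each P n is determined up to a nonzero factor. *)
Definition orthogonal_polynomials (R : realType) (a b : R) (w : R -> R)
    (P : nat -> {poly R}) : Prop :=
  (forall n, size (P n) = n.+1) /\
  (forall i j, i <> j ->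
    \int[lebesgue_measure]_(x in `[a, b]) ((P i).[x] * (P j).[x] * w x) = 0).

(* size P = d.+1 says that P has degree exactly d. *)
Definition rho_polynomial (R : realType) (alpha beta : R) (rho : R -> R)
    (d : nat) : Prop :=
  exists P : {poly R}, size P = d.+1 /\
    forall x, alpha <= x <= beta -> rho x = P.[x].

Definition rho_sqrt_polynomial (R : realType) (alpha beta : R) (rho : R -> R)
    (d : nat) : Prop :=
  exists P : {poly R}, size P = d.+1 /\
    forall x, alpha <= x <= beta -> rho x = Num.sqrt P.[x].

Definition case_i (R : realType) (alpha beta : R) (rho : R -> R) (d0 : nat) :
    Prop :=
  rho_polynomial alpha beta rho d0.

Definition case_ii (R : realType) (alpha beta gamma delta : R)
    (w2 rho : R -> R) (d1 : nat) : Prop :=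
  [/\ rho_sqrt_polynomial alpha beta rho d1,
      delta = - gamma, 0 < delta &
      forall t, gamma <= t <= delta -> w2 (- t) = w2 t].

Definition Omega (R : realType) (alpha beta gamma delta : R) (rho : R -> R) :
    set (R * R) :=
  [set z | gamma * rho z.1 <= z.2 <= delta * rho z.1 /\ alpha <= z.1 <= beta].

Definition W (R : realType) (w1 w2 rho : R -> R) (z : R * R) : R :=
  w1 z.1 * w2 (z.2 / rho z.1).

Definition inner (R : realType) (D : set (R * R)) (w : R * R -> R)
    (f g : R * R -> R) : R :=
  \int[(lebesgue_measure \x lebesgue_measure)%E]_(z in D) (f z * g z * w z).

Definition norm_inner (R : realType) (D : set (R * R)) (w : R * R -> R)
    (f : R * R -> R) : R :=
  Num.sqrt (inner D w f f).

(* Only used for k <= n.  rho may vanish at alpha or beta; there y = 0 on Omega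
   and the convention y / 0 = 0 gives the continuous extension, namely 0 for
   k > 0 and p_{n,0}(x) q_0 for k = 0. *)
Definition koornwinder (R : realType) (rho : R -> R) (p : nat -> nat -> {poly R})
    (q : nat -> {poly R}) (n k : nat) (z : R * R) : R :=
  (p (n - k)%N k).[z.1] * rho z.1 ^+ k * (q k).[z.2 / rho z.1].

(* f = O(x^l1 rho^l2 y^l3) on D with l1 + l2 + l3 < n and l3 satisfying Q.
   For the expansion of H_{n,k}, Q must allow l3 = k: the non-leading terms of
   p_{n-k,k} times the leading term of rho^k q_k(y/rho) give x^l1 y^k. *)
Definition lower_order (R : realType) (D : set (R * R)) (rho : R -> R) (n : nat)
    (Q : pred nat) (f : R * R -> R) : Prop :=
  exists r : nat -> nat -> nat -> R, forall z, D z ->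
    f z = \sum_(l1 < n) \sum_(l2 < n) \sum_(l3 < n | (l1 + l2 + l3 < n)%N && Q l3)
            r l1 l2 l3 * z.1 ^+ l1 * rho z.1 ^+ l2 * z.2 ^+ l3.

(* The upper summation limits n + (k-l)(d0-1) and n + (k-l)(d1-2)/2.  For
   l <= k <= n, the subtraction below is never truncated, whereas d0 - 1 and
   d1 - 2 would be; the division is exact when k and l have the same parity. *)
Definition upper_i (d0 n k l : nat) : nat := (n + (k - l) * d0 - (k - l))%N.

Definition upper_ii (d1 n k l : nat) : nat :=
  (n + ((k - l) * d1) %/ 2 - (k - l))%N.

(* Main.v *)
Require Import Defs.
From HB Require Import structures.
From mathcomp Require Import all_boot all_order all_algebra.
From mathcomp Require Import all_classical all_reals all_analysis.
From mathcomp Require Import measurable_realfun.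
From mathcomp Require Import zify ring lra.
From mathcomp Require finmap.

Set Implicit Arguments.
Unset Strict Implicit.
Unset Printing Implicit Defensive.

Import Order.TTheory GRing.Theory Num.Theory.
Import numFieldNormedType.Exports.

Local Open Scope classical_set_scope.
Local Open Scope ring_scope.

(** The change of variables [y = rho x * t] straightens [Omega] into the rectangle
    [[alpha, beta] x [gamma, delta]], and turns [H n k] into
    [p (n - k) k (x) * rho x ^+ k * q k (t)] and the weight into [w1 x * w2 t], with
    Jacobian [rho x].

    Orthogonality: by Fubini the inner product of [H n k] and [H m l] is the
    product of the integral of [p (n - k) k * p (m - l) l * rho ^+ (k + l + 1) * w1]
    and that of [q k * q l * w2] ([inner_koornwinder]).  The second factor vanishes
    when [k <> l]; when [k = l] the first one vanishes for [n <> m], since the weight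
    is then [rho ^+ (2 * k + 1) * w1].  The weights are only integrable and [rho] may
    vanish at [alpha] and [beta], so the substitution is carried out fibrewise, for
    measurable functions, and the two endpoints are discarded as a null set
    ([integral_fibred]).

    Expansions: on [Omega] one has [y = rho x * t] everywhere ([Omega_fibre]), so
    both formulas are algebra.  Expanding [p] and [q] into monomials gives the
    leading form of [H n k] ([koornwinder_leading]).  Conversely [t ^+ k] is a
    combination of the [q l] with [l <= k], and the coefficient of
    [rho ^+ l * q l (t)] in [x ^+ (n - k) * y ^+ k] is
    [x ^+ (n - k) * rho ^+ (k - l)].  If [rho] is a polynomial of degree [d0] this is
    a polynomial of degree [(n - k) + (k - l) * d0], hence a combination of the
    [p j l] up to that degree ([monomial_expansion]).

    If [rho] is only the square root of a polynomial, [rho ^+ (k - l)] is a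
    polynomial as soon as [k - l] is even.  Odd differences do not occur, because
    the orthogonal polynomials of an even weight on a symmetric interval have the
    parity of their degree ([orthogonal_polynomials_parity]), which in turn follows
    from the uniqueness of orthogonal polynomials up to scaling, i.e. from the
    positivity of the moment form ([moment_sqr_eq0]). *)

(** * Dilations and reflections of the line *)

(** Both sides are measures in [A], so it is enough to compare them on the
    half-open intervals, whose preimage under a dilation is explicit. *)
Lemma lebesgue_measure_dilation (R : realType) (r : R) (A : set R) :
  0 < r -> measurable A ->
  pushforward lebesgue_measure ((fun y => y / r) : _ -> measurableTypeR R) A
  = (r%:E * lebesgue_measure A)%E.
Proof.
move=> r0 mA.
have ri0 : 0 <= r^-1 by rewrite invr_ge0 ltW.
pose m := mscale (NngNum ri0)
  (pushforward lebesgue_measure ((fun y => y / r) : _ -> measurableTypeR R)).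
have mphi : measurable_fun setT
    ((fun y => y / r) : measurableTypeR R -> measurableTypeR R).
  exact: mulrr_measurable.
have -> : lebesgue_measure A = m mphi A.
  apply: lebesgue_measure_unique => //= _ [[a b]] _ <-.
  rewrite /m /mscale /= /pushforward.
  have -> : (fun y : R => y / r) @^-1` `]a, b]%classic =
      `](a * r), (b * r)]%classic.
    by apply/seteqP; split => y /=; rewrite !in_itv/= ltr_pdivlMr// ler_pdivrMr.
  rewrite !lebesgue_measure_itv/= !lte_fin ltr_pM2r//.
  case: ifP => _; last by rewrite mule0.
  rewrite -!EFinB -EFinM; congr (_%:E).
  by rewrite -mulrBl mulrCA mulVf ?mulr1 ?gt_eqF.
by rewrite /m /mscale/= muleA -EFinM divff ?gt_eqF// mul1e.
Qed.

(** The image of the Lebesgue measure under [y |-> y / r] is [r] times the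
    Lebesgue measure, so the substitution [y = r * t] requires no continuity of
    [f]; along the fibres of [Omega] the integrand contains a weight that is only
    measurable. *)
Lemma ge0_integral_dilation (R : realType) (r : R) (f : R -> \bar R) :
  0 < r -> measurable_fun setT f -> (forall t, 0 <= f t)%E ->
  (\int[lebesgue_measure]_y f (y / r)%R =
   r%:E * \int[lebesgue_measure]_t f t)%E.
Proof.
move=> r0 mf f0.
have r0' : 0 <= r by rewrite ltW.
have mphi : measurable_fun setT ((fun y => y / r) : R -> measurableTypeR R).
  exact: mulrr_measurable.
rewrite -(ge0_integral_mscale lebesgue_measure _ (NngNum r0'))//.
transitivity (\int[pushforward lebesgue_measure
    ((fun y : R => y / r)%R : R -> measurableTypeR R)]_t f t)%E.
  by rewrite ge0_integral_pushforward.
by apply: eq_measure_integral => A mA _; exact: lebesgue_measure_dilation.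
Qed.

Lemma integral_dilation (R : realType) (r : R) (f : R -> R) :
  0 < r -> lebesgue_measure.-integrable setT (EFin \o f) ->
  (\int[lebesgue_measure]_y (f (y / r)%R)%:E =
   r%:E * \int[lebesgue_measure]_t (f t)%:E)%E.
Proof.
move=> r0 fi; have mf := measurable_int _ fi.
rewrite integralE [in RHS]integralE muleBr//; last first.
  by rewrite fin_num_adde_defl// fin_numN integrable_neg_fin_num.
rewrite -!ge0_integral_dilation//=.
- by congr (_ - _)%E; apply: eq_integral => y _; rewrite ?funeposE ?funenegE.
- exact: measurable_funeneg.
- exact: measurable_funepos.
Qed.

Lemma integrable_dilation (R : realType) (r : R) (f : R -> R) :
  0 < r -> lebesgue_measure.-integrable setT (EFin \o f) ->
  lebesgue_measure.-integrable setT (fun y => (f (y / r))%:E).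
Proof.
move=> r0 /integrableP[/measurable_EFinP mf fi]; apply/integrableP; split.
  apply/measurable_EFinP; apply: (measurableT_comp mf).
  exact: mulrr_measurable.
rewrite (ge0_integral_dilation (f := fun t => `|(f t)%:E|%E))//.
  by rewrite lte_mul_pinfty// ?lee_fin ?ltW.
by apply: measurableT_comp => //; exact/measurable_EFinP.
Qed.

Lemma integral_opp (R : realType) (f : R -> R) (d : R) :
  lebesgue_measure.-integrable `[- d, d] (EFin \o f) ->
  (\int[lebesgue_measure]_(y in `[(- d)%R, d]) (f (- y)%R)%:E =
   \int[lebesgue_measure]_(t in `[(- d)%R, d]) (f t)%:E)%E.
Proof.
move=> fi.
have md : measurable `[- d, d] by exact: measurable_itv.
have pre : -%R @^-1` `[- d, d]%classic = `[- d, d]%classic.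
  by rewrite opp_preimage_itvbndbnd opprK.
have mphi : measurable_fun setT (-%R : R -> measurableTypeR R).
  exact: oppr_measurable.
have push (g : R -> \bar R) : measurable_fun `[-d, d] g ->
  (forall t, 0 <= g t)%E ->
  (\int[lebesgue_measure]_(y in `[(- d)%R, d]) (g (- y)%R) =
   \int[lebesgue_measure]_(t in `[(- d)%R, d]) (g t))%E.
  move=> mg g0; transitivity (\int[pushforward lebesgue_measure
      (-%R : R -> measurableTypeR R)]_(t in `[(- d)%R, d]) (g t))%E.
    by rewrite ge0_integral_pushforward// pre.
  by apply: eq_measure_integral => A mA _; rewrite /= lebesgue_measureN.
have mf := measurable_int _ fi.
have hp := push _ (measurable_funepos mf) (funepos_ge0 _).
have hn := push _ (measurable_funeneg mf) (funeneg_ge0 _).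
rewrite integralE [in RHS]integralE -[X in _ = (X - _)%E]hp.
rewrite -[X in _ = (_ - X)%E]hn.
by congr (_ - _)%E; apply: eq_integral => y _; rewrite ?funeposE ?funenegE.
Qed.

(** * The inner product over a fibred region *)

(** The two endpoints are a null set, so nothing has to be known about [J] there;
    this absorbs the points where [rho] may vanish. *)
Lemma integral_itv_support (R : realType) (a b : R) (J : R -> \bar R) :
  measurable_fun setT J -> (forall x, ~ (a <= x <= b) -> J x = 0%E) ->
  (\int[lebesgue_measure]_x J x =
   \int[lebesgue_measure]_(x in `]a, b[) J x)%E.
Proof.
move=> mJ J0.
rewrite -(@integral_itv_bndoo R a b J true false); last first.
  exact: measurable_funTS.
rewrite [RHS]integral_mkcond; apply: eq_integral => x _; rewrite patchE.
case: ifPn => // /negP xab; apply: J0 => h; apply: xab.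
by rewrite inE/= in_itv.
Qed.

(** Fubini on a region fibred over an interval: on the fibre above [x] the
    substitution [y = rho x * t] turns the inner integral into a constant
    multiple of [A x * rho x].  The values of [g] above the endpoints [a] and [b]
    are left unconstrained. *)
Lemma integral_fibred (R : realType) (a b : R) (A B rho : R -> R)
    (g : R * R -> R) :
  measurable_fun setT g ->
  (forall x y, ~ (a <= x <= b) -> g (x, y) = 0) ->
  (forall x y, a < x < b -> g (x, y) = A x * B (y / rho x)) ->
  (forall x, a < x < b -> 0 < rho x) ->
  lebesgue_measure.-integrable `]a, b[ (fun x => (A x * rho x)%:E) ->
  lebesgue_measure.-integrable setT (EFin \o B) ->
  (\int[(lebesgue_measure \x lebesgue_measure)]_z (g z)%:E =
   (\int[lebesgue_measure]_(x in `]a, b[) (A x * rho x)%:E) *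
   \int[lebesgue_measure]_t (B t)%:E)%E.
Proof.
move=> mg g0 gE rho0 Ai Bi.
have mgE : measurable_fun setT (EFin \o g) by exact/measurable_EFinP.
have mag : measurable_fun setT (abse \o (EFin \o g)) by exact: measurableT_comp.
have mab : measurable `]a, b[%classic by exact: measurable_itv.
have gi : ((@lebesgue_measure R) \x (@lebesgue_measure R))%E.-integrable setT
    (EFin \o g).
  (* By Tonelli the integral of [`|g|] is that of [`|A * rho|] times that of
     [`|B|], and both are finite. *)
  apply/integrable12ltyP => //.
  rewrite (@integral_itv_support _ a b); last 2 first.
  - exact: (measurable_fun_fubini_tonelli_F (m2 := @lebesgue_measure R)
      (abse \o (EFin \o g)) mag (fun=> abse_ge0 _)).
  - move=> x xab; rewrite integral0_eq// => y _.
    by rewrite /= g0// normr0.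
  rewrite [X in (X < _)%E](_ : _ = \int[lebesgue_measure]_(x in `]a, b[)
      (`|(A x * rho x)%:E| * \int[lebesgue_measure]_t `|(B t)%:E|))%E;
    last first.
    apply: eq_integral => x; rewrite inE/= in_itv/= => xab.
    have r0 := rho0 _ xab.
    transitivity (\int[lebesgue_measure]_y
        (`|A x|%:E * (`|B (y / rho x)%R|)%:E))%E.
      by apply: eq_integral => y _; rewrite /= gE// normrM.
    rewrite ge0_integralZl_EFin//; last first.
      apply/measurable_EFinP; apply: measurableT_comp => //.
      have /measurable_EFinP mB := measurable_int _ Bi.
      apply: (measurableT_comp mB).
      exact: mulrr_measurable.
    rewrite (ge0_integral_dilation (f := fun t => (`|B t|)%:E))//; last first.
      apply/measurable_EFinP; apply: measurableT_comp => //.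
      by have /measurable_EFinP := measurable_int _ Bi.
    by rewrite muleA -EFinM /= normrM (gtr0_norm r0).
  rewrite ge0_integralZr//.
  - have := Bi => /integrableP[_ hB]; have := Ai => /integrableP[_ hA].
    apply: lte_mul_pinfty => //; first exact: integral_ge0.
    by rewrite ge0_fin_numE//; exact: integral_ge0.
  - apply: measurableT_comp => //; exact: measurable_int Ai.
  - exact: integral_ge0.
rewrite -integral12_prod_meas1//.
transitivity (\int[lebesgue_measure]_(x in `]a, b[)
    fubini_F (@lebesgue_measure R) (EFin \o g) x)%E.
  apply: integral_itv_support; first exact: (measurable_fubini_F gi).
  move=> x xab; rewrite /fubini_F integral0_eq// => y _.
  by rewrite /= g0.
transitivity (\int[lebesgue_measure]_(x in `]a, b[)
    ((A x * rho x)%:E * \int[lebesgue_measure]_t (B t)%:E))%E.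
  apply: eq_integral => x; rewrite inE/= in_itv/= => xab.
  have r0 := rho0 _ xab.
  transitivity (\int[lebesgue_measure]_y ((A x)%:E * (B (y / rho x)%R)%:E))%E.
    by apply: eq_integral => y _; rewrite /= gE.
  rewrite integralZl//; last first.
    exact: integrable_dilation.
  by rewrite integral_dilation// muleA EFinM.
have Bf : (\int[lebesgue_measure]_t (B t)%:E)%E \is a fin_num.
  exact: integrable_fin_num.
by rewrite -(fineK Bf) integralZr.
Qed.

Lemma integrable_continuousM (R : realType) (a b : R) (g w : R -> R) :
  continuous g -> lebesgue_measure.-integrable `[a, b] (EFin \o w) ->
  lebesgue_measure.-integrable `[a, b] (fun x => (g x * w x)%:E).
Proof.
move=> cg wi.
rewrite (_ : (fun _ => _) = ((EFin \o g) \* (EFin \o w))%E); last first.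
  by apply/funext => x; rewrite /= EFinM.
apply: integrableMr => //.
- exact: measurable_funTS (continuous_measurable_fun cg).
- have := compact_bounded (continuous_compact (continuous_subspaceT cg)
    (@segment_compact _ a b)).
  rewrite /bounded_set /bounded_near/=; apply: filterS => M hM x xab.
  by apply: hM; exists x.
Qed.

Lemma integral_itv_oo_cc (R : realType) (a b : R) (w : R -> R) :
  lebesgue_measure.-integrable `[a, b] (EFin \o w) ->
  (\int[lebesgue_measure]_(x in `]a, b[) (w x)%:E =
  \int[lebesgue_measure]_(x in `[a, b]) (w x)%:E)%E.
Proof.
move=> wi; rewrite -(@integral_itv_bndoo R a b (EFin \o w) true false)//.
apply: measurable_funS (measurable_int _ wi) => //.
exact: subset_itv_oo_cc.
Qed.

(** Division is not continuous at the zeros of [r], but [x^-1] agrees with the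
    real power of exponent [-1] on nonnegative numbers (both vanish at [0]),
    and real powers are measurable. *)
Lemma measurable_inv_norm (R : realType) (r : R -> R) :
  continuous r -> measurable_fun setT (fun x => `|r x|^-1).
Proof.
move=> cr.
rewrite (_ : (fun _ => _) = (fun x => (`|r x|) `^ (-1))); last first.
  by apply/funext => x; rewrite powR_inv1.
apply: (measurableT_comp (measurable_powR (-1))).
apply: (measurableT_comp (@normr_measurable R setT)).
exact: continuous_measurable_fun.
Qed.

Lemma measurable_Omega (R : realType) (alpha beta gamma delta : R)
    (rho rhoc : R -> R) :
  continuous rhoc -> {in `[alpha, beta], rho =1 rhoc} ->
  measurable (Omega alpha beta gamma delta rho).
Proof.
move=> crho rhoE.
have mrho : measurable_fun [set: R * R] (fun z : R * R => rhoc z.1).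
  by apply: measurableT_comp => //; exact: continuous_measurable_fun.
have -> : Omega alpha beta gamma delta rho =
  [set z | gamma * rhoc z.1 <= z.2] `&` [set z | z.2 <= delta * rhoc z.1] `&`
  [set z | alpha <= z.1] `&` [set z | z.1 <= beta].
  apply/seteqP; split => -[x y] /=.
    rewrite /Omega /= => -[/andP[h1 h2] /andP[h3 h4]].
    have e : rho x = rhoc x by apply: rhoE; rewrite in_itv/= h3.
    by rewrite -e.
  rewrite /Omega /= => -[[[h1 h2] h3] h4].
  have e : rho x = rhoc x by apply: rhoE; rewrite in_itv/= h3.
  by rewrite e h1 h2 h3 h4.
have mle (f g : R * R -> R) : measurable_fun setT f -> measurable_fun setT g ->
    measurable [set z | f z <= g z].
  move=> mf mg; rewrite (_ : [set _ | _] = [set: R * R] `&`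
     (fun z => f z <= g z) @^-1` [set true]); last by rewrite setTI.
  exact: measurable_fun_ler.
apply: measurableI; last exact: mle.
apply: measurableI; last exact: mle.
by apply: measurableI; apply: mle => //; apply: measurable_funM.
Qed.

(** The Jacobian of [y = rho x * t] supplies the extra factor [rho x], and the
    double integral splits into two single ones.  A continuous extension [rhoc]
    of [rho] is what makes [Omega] measurable and [rho] bounded. *)
Lemma inner_fibred (R : realType) (alpha beta gamma delta : R)
    (w1 w2 rho rhoc A B : R -> R) (f g : R * R -> R) :
  gamma < delta ->
  continuous rhoc -> {in `[alpha, beta], rho =1 rhoc} ->
  (forall x, alpha < x < beta -> 0 < rho x) ->
  lebesgue_measure.-integrable `[alpha, beta] (EFin \o w1) ->
  lebesgue_measure.-integrable `[gamma, delta] (EFin \o w2) ->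
  continuous A -> continuous B ->
  (forall z, Omega alpha beta gamma delta rho z ->
    f z * g z = A z.1 * B (z.2 / rho z.1)) ->
  inner (Omega alpha beta gamma delta rho) (W w1 w2 rho) f g =
  (\int[lebesgue_measure]_(x in `[alpha, beta]) (A x * rho x * w1 x)) *
  (\int[lebesgue_measure]_(t in `[gamma, delta]) (B t * w2 t)).
Proof.
move=> gd crho rhoE rho0 w1i w2i cA cB fgE.
have mOm := @measurable_Omega R alpha beta gamma delta rho rhoc crho rhoE.
set Om := Omega _ _ _ _ _ in mOm *.
have mab : measurable (`[alpha, beta]%classic : set R) by exact: measurable_itv.
have mgd : measurable (`[gamma, delta]%classic : set R) by exact: measurable_itv.
pose G : R * R -> R :=
  (fun z => A z.1 * B (z.2 / rho z.1) * W w1 w2 rho z) \_ Om.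
(* The weights are measurable on their intervals only, so they are cut off.  At
   an endpoint where [rho] vanishes [z.2 / rho z.1] is [0], which may lie outside
   [gamma, delta]; [B1] keeps this one extra value, and agrees with [B0] on the
   fibres over the open interval. *)
pose A1 : R -> R := (fun x => A x * w1 x) \_ `[alpha, beta].
pose B0 : R -> R := (fun t => B t * w2 t) \_ `[gamma, delta].
pose B1 : R -> R := (fun t => B t * w2 t) \_ (`[gamma, delta] `|` [set 0]).
have Bwi := integrable_continuousM cB w2i.
have Awi : lebesgue_measure.-integrable `[alpha, beta]
    (fun x => (A x * rho x * w1 x)%:E).
  apply: (@eq_integrable _ _ _ (@lebesgue_measure R) _ mab
    (fun x : R => (A x * rhoc x * w1 x)%:E)) => //.
    by move=> x; rewrite inE/= => xab; rewrite rhoE.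
  apply: integrable_continuousM => // x.
  by apply: continuousM; [exact: cA|exact: crho].
have mG : measurable_fun setT G.
  apply: (measurable_restrictT _ mOm).1.
  apply: (@eq_measurable_fun _ _ _ _ Om
    (fun z : R * R => A1 z.1 * B1 (z.2 * `|rhoc z.1|^-1))).
    move=> [x y]; rewrite inE /Om /Omega /= => -[/andP[h1 h2] h3].
    have e : rho x = rhoc x by apply: rhoE; rewrite in_itv/=.
    (* As [gamma < delta], a negative [rho x] would make the fibre empty. *)
    have r0 : 0 <= rho x.
      rewrite leNgt; apply/negP => rn.
      have := le_trans h1 h2; rewrite ler_nM2r// leNgt.
      by rewrite gd.
    rewrite -e ger0_norm// /A1 /B1 !patchE /W/= ifT; last first.
      by rewrite inE/= in_itv.
    rewrite ifT; last first.
      rewrite inE/=; have [r1|r1] := eqVneq (rho x) 0.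
        by right; rewrite r1 invr0 mulr0.
      have rp : 0 < rho x by rewrite lt_neqAle eq_sym r1.
      by left; rewrite in_itv/= ler_pdivlMr// ler_pdivrMr// h1.
    by rewrite mulrACA.
  apply: measurable_funTS; apply: measurable_funM.
    apply: (@measurableT_comp _ _ _ _ _ _ A1) => //.
    apply: (measurable_restrictT _ mab).1.
    apply: measurable_funM.
      exact: measurable_funTS (continuous_measurable_fun cA).
    by apply/measurable_EFinP; exact: measurable_int w1i.
  apply: (@measurableT_comp _ _ _ _ _ _ B1) => //; last first.
    apply: measurable_funM => //.
    exact: (measurableT_comp (measurable_inv_norm crho)).
  apply: (measurable_restrictT _ _).1; first exact: measurableU.
  apply/measurable_funU => //; split; last exact: measurable_fun_set1.
  by apply/measurable_EFinP; exact: measurable_int Bwi.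
have IG : (\int[(@lebesgue_measure R \x @lebesgue_measure R)]_(z in Om)
    (f z * g z * W w1 w2 rho z)%:E =
  \int[(@lebesgue_measure R \x @lebesgue_measure R)]_z (G z)%:E)%E.
  rewrite integral_mkcond; apply: eq_integral => z _.
  rewrite /G !patchE; case: ifPn => //; rewrite inE => zO.
  by rewrite fgE.
have IB : (\int[lebesgue_measure]_t (B0 t)%:E =
  \int[lebesgue_measure]_(t in `[gamma, delta]) (B t * w2 t)%:E)%E.
  rewrite [RHS]integral_mkcond; apply: eq_integral => t _.
  by rewrite /B0 !patchE; case: ifP.
have IA : (\int[lebesgue_measure]_(x in `]alpha, beta[)
    (A x * w1 x * rho x)%:E =
  \int[lebesgue_measure]_(x in `[alpha, beta]) (A x * rho x * w1 x)%:E)%E.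
  rewrite -integral_itv_oo_cc//; apply: eq_integral => x _.
  by rewrite mulrAC.
rewrite /inner /Rintegral IG.
rewrite (@integral_fibred R alpha beta (fun x => A x * w1 x) B0 rho)//.
- by rewrite IB IA fineM//; exact: integrable_fin_num.
- move=> x y xab; rewrite /G patchE ifF//; apply/negbTE/negP.
  by rewrite inE /Om /Omega /= => -[].
- move=> x y xab; have r0 := rho0 _ xab; rewrite /G /B0 !patchE.
  have xab' : alpha <= x <= beta by case/andP: xab => /ltW-> /ltW->.
  have -> : ((x, y) \in Om) = (y / rho x \in `[gamma, delta]%classic).
    apply/idP/idP; rewrite !inE /Om /Omega /= in_itv/= ler_pdivlMr//;
      by rewrite ler_pdivrMr//; case.
  case: ifP => _; last by rewrite mulr0.
  by rewrite /W/= mulrACA.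
- apply: (@eq_integrable _ _ _ (@lebesgue_measure R) _ _
    (fun x : R => (A x * rho x * w1 x)%:E)) => //.
    by move=> x _; rewrite mulrAC.
  by apply: integrableS Awi => //; exact: subset_itv_oo_cc.
- rewrite (_ : EFin \o B0 = (EFin \o (fun t => B t * w2 t)) \_ `[gamma, delta]).
    by rewrite -integrable_mkcond.
  by apply/funext => t; rewrite /B0 /= !patchE; case: ifP.
Qed.

(** * Polynomial bases and reflection *)

(** By induction on the degree: subtracting a multiple of [P N] kills the
    coefficient of degree [N]. *)
Lemma poly_basis_span (F : fieldType) (P : nat -> {poly F}) (N : nat)
    (f : {poly F}) :
  (forall n, size (P n) = n.+1) -> (size f <= N)%N ->
  exists b : nat -> F, f = \sum_(0 <= j < N) b j *: P j.
Proof.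
move=> sP; elim: N f => [|N IH] f sf.
  by exists (fun=> 0); rewrite big_nil; apply/eqP; rewrite -size_poly_leq0.
have PN0 : (P N)`_N != 0.
  have <- : lead_coef (P N) = (P N)`_N by rewrite lead_coefE sP.
  by rewrite lead_coef_eq0 -size_poly_eq0 sP.
pose g := f - (f`_N / (P N)`_N) *: P N.
have sg : (size g <= N)%N.
  apply/leq_sizeP => j; rewrite leq_eqVlt => /predU1P[<-|Nj].
    by rewrite coefB coefZ divfK// subrr.
  rewrite coefB coefZ [f`_j]nth_default ?(leq_trans sf)//.
  by rewrite [(P N)`_j]nth_default ?sP// mulr0 subrr.
have [b gb] := IH _ sg.
exists (fun j => if j == N then f`_N / (P N)`_N else b j).
rewrite big_nat_recr//= eqxx -[LHS](subrK ((f`_N / (P N)`_N) *: P N)) -/g gb.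
congr (_ + _); rewrite !big_nat; apply: eq_bigr => j /andP[_ jN].
by rewrite ltn_eqF.
Qed.

Lemma coef_comp_polyNX (F : comNzRingType) (f : {poly F}) (i : nat) :
  (f \Po - 'X)`_i = (-1) ^+ i * f`_i.
Proof.
have -> : f \Po - 'X = \poly_(j < size f) ((-1) ^+ j * f`_j).
  rewrite comp_polyE poly_def; apply: eq_bigr => j _.
  rewrite [(- 'X) ^+ _]exprNn -signr_odd -[in RHS]signr_odd.
  by case: odd; rewrite /= ?expr0 ?expr1 ?mulN1r ?mul1r ?scalerN ?scaleNr.
by rewrite coef_poly; case: ltnP => // fi; rewrite (nth_default _ fi) mulr0.
Qed.

Lemma size_comp_polyNX (F : idomainType) (f : {poly F}) :
  size (f \Po - 'X) = size f.
Proof. by rewrite size_comp_poly2// size_polyN size_polyX. Qed.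

Lemma comp_polyNXK (F : comNzRingType) (f : {poly F}) :
  (f \Po - 'X) \Po - 'X = f.
Proof.
by apply/polyP => i; rewrite !coef_comp_polyNX mulrA -expr2 sqrr_sign mul1r.
Qed.

Lemma pow_sqrt_even (R : rcfType) (x : R) (m : nat) :
  0 <= x -> ~~ odd m -> Num.sqrt x ^+ m = x ^+ m./2.
Proof.
move=> x0 em; rewrite -{1}(odd_double_half m) (negPf em) add0n -mul2n exprM.
by rewrite sqr_sqrtr.
Qed.

Lemma size_monomial_pow_leq (R : idomainType) (P : {poly R}) (m e d : nat) :
  (size P <= d.+1)%N -> (size ('X^m * P ^+ e)%R <= (m + e * d).+1)%N.
Proof.
move=> sP; apply: leq_trans (size_polyMleq _ _) _.
rewrite size_polyXn /= -addnS leq_add2l.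
apply: leq_trans (size_poly_exp_leq _ _) _; rewrite ltnS mulnC leq_mul2l.
by apply/orP; right; case: (size P) sP => // s; rewrite ltnS.
Qed.

(** A negative value at an endpoint would force, by the intermediate value
    theorem, a root in the open interval. *)
Lemma poly_ge0_closure (R : rcfType) (a b : R) (P : {poly R}) : a < b ->
  (forall x, a < x < b -> 0 < P.[x]) -> forall x, a <= x <= b -> 0 <= P.[x].
Proof.
move=> ab P0; pose m := (a + b) / 2.
have [am mb] : a < m /\ m < b by rewrite /m; split; lra.
have Pm : 0 <= P.[m] by rewrite ltW// P0// am.
move=> x /andP[ax xb]; rewrite leNgt; apply/negP => Px.
have [xm|mx] := leP x m.
  have [|y] := @poly_ivt _ P x m xm; first by rewrite (ltW Px) Pm.
  move=> /andP[xy ym] /rootP Py.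
  have : x != y by apply: contraTneq Px => ->; rewrite Py ltxx.
  rewrite neq_lt [y < x]ltNge xy orbF => xy'.
  have := P0 y; rewrite (le_lt_trans ax xy') (le_lt_trans ym mb) Py ltxx.
  by move/(_ isT).
have [|y] := @poly_ivt _ (- P) m x (ltW mx).
  by rewrite !hornerN oppr_le0 oppr_ge0 Pm ltW.
move=> /andP[my yx]; rewrite rootN => /rootP Py.
have : y != x by apply: contraTneq Px => <-; rewrite Py ltxx.
rewrite neq_lt [x < y]ltNge yx orbF => yx'.
have := P0 y; rewrite (lt_le_trans am my) (lt_le_trans yx' xb) Py ltxx.
by move/(_ isT).
Qed.

(** * Orthogonal polynomials of an even weight *)

Lemma finite_root (R : idomainType) (f : {poly R}) : f != 0 ->
  finite_set [set x | root f x].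
Proof.
move=> f0; apply: contrapT => /(infinite_set_fset (size f))[B BA].
apply/negP; rewrite -ltnNge.
apply: (@max_poly_roots _ f (finmap.enum_fset B)) f0 _ (finmap.fset_uniq B).
by apply/allP => x xB; exact: BA.
Qed.

Section Moment.

Variables (R : realType) (a b : R) (w : R -> R).
Hypothesis wi : lebesgue_measure.-integrable `[a, b] (EFin \o w).

(** The linear functional whose bilinear form [moment (f * g)] is the inner
    product of [f] and [g] for the weight [w]. *)
Definition moment (f : {poly R}) :=
  \int[lebesgue_measure]_(x in `[a, b]) (f.[x] * w x).

Lemma integrable_moment (f : {poly R}) :
  lebesgue_measure.-integrable `[a, b] (fun x => (f.[x] * w x)%:E).
Proof. by apply: integrable_continuousM => //; exact: continuous_horner. Qed.

Lemma momentD f g : moment (f + g) = moment f + moment g.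
Proof.
rewrite /moment -RintegralD//; [|exact: integrable_moment..].
by apply: eq_Rintegral => x _; rewrite hornerD mulrDl.
Qed.

Lemma momentZ c f : moment (c *: f) = c * moment f.
Proof.
rewrite /moment -RintegralZl//; last exact: integrable_moment.
by apply: eq_Rintegral => x _; rewrite hornerZ mulrA.
Qed.

Lemma moment_sum (I : Type) (s : seq I) (F : I -> {poly R}) :
  moment (\sum_(i <- s) F i) = \sum_(i <- s) moment (F i).
Proof.
apply: (big_morph moment momentD).
by rewrite -[0](scale0r 0) momentZ mul0r.
Qed.

Lemma moment_orthogonal_lower (P : nat -> {poly R}) (k : nat) (f : {poly R}) :
  orthogonal_polynomials a b w P -> (size f <= k)%N -> moment (P k * f) = 0.
Proof.
move=> [sP oP] fk; have [c ->] := poly_basis_span sP fk.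
rewrite big_distrr moment_sum big_nat big1//= => j jk.
rewrite -scalerAr momentZ; apply/eqP; rewrite mulf_eq0; apply/orP; right.
apply/eqP; rewrite -[RHS](oP k j); last by move=> kj; rewrite kj ltnn in jk.
by apply: eq_Rintegral => x _; rewrite hornerM.
Qed.

(** A weight makes the moment form positive definite on polynomials: if the
    integral of [f ^+ 2 * w] vanishes then [w] vanishes almost everywhere off the
    finitely many roots of [f], which contradicts the positive mass of [w]. *)
Lemma moment_sqr_eq0 (f : {poly R}) : weight_on a b w ->
  moment (f * f) = 0 -> f = 0.
Proof.
move=> [w0 _ wpos] fw0; apply/eqP/negP => /negP f0.
have mo : measurable (`]a, b[%classic : set R) by exact: measurable_itv.
have ffi := integrable_moment (f * f).
have mw : measurable_fun `]a, b[ (EFin \o w).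
  by apply: measurable_funS (measurable_int _ wi) => //; exact: subset_itv_oo_cc.
have mff : measurable_fun `]a, b[ (fun x => ((f * f).[x] * w x)%:E).
  by apply: measurable_funS (measurable_int _ ffi) => //; exact: subset_itv_oo_cc.
have I0 : (\int[lebesgue_measure]_(x in `]a, b[)
    `|((f * f).[x] * w x)%:E| = 0)%E.
  transitivity (\int[lebesgue_measure]_(x in `]a, b[) ((f * f).[x] * w x)%:E)%E.
    apply: eq_integral => x; rewrite inE/= in_itv/= => xab.
    by rewrite ger0_norm// mulr_ge0 ?w0// hornerM -expr2 sqr_ge0.
  rewrite integral_itv_oo_cc// -[LHS]fineK; last exact: integrable_fin_num.
  by congr (_%:E).
have := (ae_eq_integral_abs lebesgue_measure mo mff).1 I0.
have N0 : lebesgue_measure.-negligible [set x | root f x].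
  have fc : countable [set x | root f x].
    by apply: finite_set_countable; exact: finite_root.
  exists [set x | root f x]; split => //.
    by apply: countable_measurable => // t; exact: measurable_set1.
  exact: countable_lebesgue_measure0.
move=> ffae.
have wae : ae_eq lebesgue_measure `]a, b[%classic (EFin \o w) (cst 0)%E.
  have N0' : {ae (@lebesgue_measure R), forall x, ~~ root f x}.
    apply: negligibleS N0 => x /=.
    by move=> /negP; rewrite negbK.
  apply: filterS2 ffae N0' => x hx /negPf fx xab /=.
  have := hx xab => -[/eqP]; rewrite hornerM !mulf_eq0 -!rootE fx/=.
  by move=> /eqP ->.
have W0 : (\int[lebesgue_measure]_(x in `]a, b[) (w x)%:E = 0)%E.
  transitivity (\int[lebesgue_measure]_(x in `]a, b[) (cst 0%E x : \bar R))%E.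
    by apply: ae_eq_integral => //; exact: measurable_cst.
  exact: integral0.
by move: wpos; rewrite /Rintegral -integral_itv_oo_cc// W0 ltxx.
Qed.

End Moment.

Lemma moment_comp_polyNX (R : realType) (d : R) (w : R -> R) (f : {poly R}) :
  lebesgue_measure.-integrable `[- d, d] (EFin \o w) ->
  (forall t, - d <= t <= d -> w (- t) = w t) ->
  moment (- d) d w (f \Po - 'X) = moment (- d) d w f.
Proof.
move=> wi we.
have fi := integrable_moment wi f.
rewrite /moment /Rintegral; congr fine.
rewrite -(@integral_opp R (fun x => f.[x] * w x))//.
apply: eq_integral => x; rewrite inE/= in_itv/= => xd.
by rewrite horner_comp hornerN hornerX we.
Qed.

(** The reflection [P k (- x)] is again orthogonal to all lower degrees, because
    the weight is even.  Its difference [r] with [(-1) ^+ k *: P k] has degree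
    below [k], hence is orthogonal to itself and vanishes. *)
Lemma orthogonal_polynomials_parity (R : realType) (d : R) (w : R -> R)
    (P : nat -> {poly R}) (k : nat) :
  weight_on (- d) d w -> (forall t, - d <= t <= d -> w (- t) = w t) ->
  orthogonal_polynomials (- d) d w P ->
  P k \Po - 'X = (-1) ^+ k *: P k.
Proof.
move=> ww we oP; have [_ wi _] := ww; have [sP _] := oP.
apply/eqP; rewrite -subr_eq0; apply/eqP.
set r := _ - _.
have sr : (size r <= k)%N.
  apply/leq_sizeP => j; rewrite leq_eqVlt => /predU1P[<-|kj].
    by rewrite coefB coefZ coef_comp_polyNX subrr.
  by rewrite coefB coefZ coef_comp_polyNX nth_default ?sP// !mulr0 subrr.
apply: (moment_sqr_eq0 wi) => //.
(* Expand one factor of [r * r] and move the reflection onto the other one, so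
   that both terms pair [P k] with a polynomial of lower degree. *)
have -> : r * r = (P k * (r \Po - 'X)) \Po - 'X + (- (-1) ^+ k) *: (P k * r).
  by rewrite comp_polyM comp_polyNXK {1}/r mulrBl scaleNr scalerAl.
rewrite momentD// momentZ// moment_comp_polyNX//.
rewrite !(moment_orthogonal_lower wi oP)// ?size_comp_polyNX//.
by rewrite mulr0 addr0.
Qed.

Lemma parity_coef_eq0 (R : realType) (f : {poly R}) (k j : nat) :
  f \Po - 'X = (-1) ^+ k *: f -> odd j != odd k -> f`_j = 0.
Proof.
move=> /polyP/(_ j); rewrite coef_comp_polyNX coefZ -signr_odd -[in RHS]signr_odd.
by case: (odd j); case: (odd k) => //=; rewrite expr0 expr1 => h _; lra.
Qed.

(** The monomial of degree [k] is fixed by the projection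
    [f |-> (f + (-1) ^+ k f(- x)) / 2], which kills every [q l] with [l] of the
    other parity. *)
Lemma monomial_parity_span (R : realType) (q : nat -> {poly R}) (k : nat) :
  (forall n, size (q n) = n.+1) ->
  (forall n, q n \Po - 'X = (-1) ^+ n *: q n) ->
  exists a : nat -> R,
    'X^k = \sum_(0 <= l < k.+1 | l == k %[mod 2]) a l *: q l.
Proof.
move=> sq qN; have [a aE] : exists a : nat -> R,
    'X^k = \sum_(0 <= l < k.+1) a l *: q l.
  by apply: (poly_basis_span sq); rewrite size_polyXn.
exists a.
have XN : 'X^k = (-1) ^+ k *: ('X^k \Po - 'X) :> {poly R}.
  by apply/polyP => i; rewrite coefZ coef_comp_polyNX coefXn;
    case: eqVneq => [->|]; rewrite ?mulr0// mulr1 -expr2 sqrr_sign.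
have -> : 'X^k = 2^-1 *: ('X^k + (-1) ^+ k *: ('X^k \Po - 'X)) :> {poly R}.
  by rewrite -XN; apply/polyP => i; rewrite coefZ coefD; lra.
rewrite aE raddf_sum scaler_sumr -big_split scaler_sumr/= [RHS]big_mkcond/=.
apply: eq_bigr => l _; rewrite comp_polyZ qN !modn2.
rewrite -(signr_odd _ k) -(signr_odd _ l).
by apply/polyP => i; case: (odd l); case: (odd k) => /=;
  rewrite ?(coefZ, coefD, coef0) ?expr0 ?expr1; lra.
Qed.

(** * Expansions in powers of x, rho and y *)

Section LowerOrder.

Variables (R : realType) (D : set (R * R)) (rho : R -> R) (n : nat).
Variable Q : pred nat.

Lemma lower_order0 : lower_order D rho n Q (fun=> 0).
Proof.
exists (fun _ _ _ => 0) => z _; symmetry.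
do 3! apply: big1 => ? _.
by rewrite !mul0r.
Qed.

Lemma lower_orderD f g : lower_order D rho n Q f -> lower_order D rho n Q g ->
  lower_order D rho n Q (fun z => f z + g z).
Proof.
move=> [r fr] [s gs]; exists (fun i j k => r i j k + s i j k) => z Dz.
rewrite fr// gs// -big_split/=; apply: eq_bigr => i _.
rewrite -big_split/=; apply: eq_bigr => j _.
by rewrite -big_split/=; apply: eq_bigr => k _; rewrite !mulrDl.
Qed.

Lemma lower_order_sum (I : Type) (s : seq I) (f : I -> R * R -> R) :
  (forall i, lower_order D rho n Q (f i)) ->
  lower_order D rho n Q (fun z => \sum_(i <- s) f i z).
Proof.
move=> fi; elim: s => [|i s IH].
  have [r h] := lower_order0; exists r => z Dz; rewrite big_nil; exact: h.
have [r h] := lower_orderD (fi i) IH; exists r => z Dz.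
by rewrite big_cons h.
Qed.

(** Together with closure under sums, this reduces every remainder estimate to
    a count of exponents. *)
Lemma lower_order_monomial (a : R) (i j k : nat) : (i + j + k < n)%N -> Q k ->
  lower_order D rho n Q (fun z => a * z.1 ^+ i * rho z.1 ^+ j * z.2 ^+ k).
Proof.
move=> ijk Qk.
have [ni nj nk] : [/\ (i < n)%N, (j < n)%N & (k < n)%N] by split; lia.
exists (fun l1 l2 l3 => if [&& l1 == i, l2 == j & l3 == k] then a else 0) => z _.
rewrite (bigD1 (Ordinal ni))//= [X in _ + X]big1 ?addr0; last first.
  move=> l1 /negPf l1i; apply: big1 => l2 _; apply: big1 => l3 _.
  by rewrite -(inj_eq val_inj)/= in l1i; rewrite l1i/= !mul0r.
rewrite (bigD1 (Ordinal nj))//= [X in _ + X]big1 ?addr0; last first.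
  move=> l2 /negPf l2j; apply: big1 => l3 _.
  by rewrite -(inj_eq val_inj)/= in l2j; rewrite l2j/= andbF !mul0r.
rewrite (bigD1 (Ordinal nk))/= ?ijk// [X in _ + X]big1 ?addr0; last first.
  move=> l3 /andP[_ /negPf l3k].
  by rewrite -(inj_eq val_inj)/= in l3k; rewrite l3k/= !andbF !mul0r.
by rewrite !eqxx.
Qed.

End LowerOrder.

(** Where [rho] vanishes the fibre of [Omega] is the single point [y = 0], so the
    convention [y / 0 = 0] does no harm: writing [y = rho x * t] is legitimate
    on all of [Omega], and the identities below become identities of
    polynomials in [x], [rho x] and [t]. *)
Lemma Omega_fibre (R : realType) (alpha beta gamma delta : R) (rho : R -> R) z :
  Omega alpha beta gamma delta rho z -> z.2 = rho z.1 * (z.2 / rho z.1).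
Proof.
case: z => x y [/= /andP[h1 h2] _].
have [r0|r0] := eqVneq (rho x) 0; last by rewrite mulrC divfK.
rewrite r0 mul0r; apply/eqP; rewrite eq_le.
by move: h1 h2; rewrite r0 !mulr0 => -> ->.
Qed.

(** Since [rho ^+ k * t ^+ j = rho ^+ (k - j) * y ^+ j], the coefficients of
    [q k] distribute [H n k] over terms of degree [k] in [rho] and [y] together.
    The leading coefficient of [p (n - k) k] gives the terms of total degree [n];
    all others have total degree below [n].  The predicates [S] and [Q] record
    which powers of [y] occur, i.e. the parity of [q k]. *)
Lemma koornwinder_leading (R : realType) (D : set (R * R)) (rho : R -> R)
    (p : nat -> nat -> {poly R}) (q : nat -> {poly R}) (n k : nat)
    (S Q : pred nat) :
  (forall z, D z -> z.2 = rho z.1 * (z.2 / rho z.1)) ->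
  size (p (n - k)%N k) = (n - k).+1 -> size (q k) = k.+1 ->
  (forall j, (j <= k)%N -> (q k)`_j != 0 -> S j && Q j) ->
  exists c : nat -> R, lower_order D rho n Q (fun z => koornwinder rho p q n k z -
    \sum_(j < k.+1 | S j) c j * z.1 ^+ (n - k) * rho z.1 ^+ (k - j) * z.2 ^+ j).
Proof.
move=> fib sp sq qSQ.
pose a := (p (n - k)%N k : seq R); pose b := (q k : seq R).
exists (fun j => a`_(n - k) * b`_j).
have : lower_order D rho n Q (fun z =>
   \sum_(i < n - k) \sum_(j < k.+1)
     a`_i * b`_j * z.1 ^+ i * rho z.1 ^+ (k - j) * z.2 ^+ j).
  apply: lower_order_sum => i; apply: lower_order_sum => j.
  have jk : (j <= k)%N by rewrite -ltnS.
  have [bj|bj] := eqVneq (b`_j) 0.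
    have [r h] := lower_order0 D rho n Q; exists r => z Dz; rewrite -h//.
    by rewrite bj mulr0 !mul0r.
  apply: lower_order_monomial; last by case/andP: (qSQ _ jk bj).
  by have := ltn_ord i; lia.
case=> r h; exists r => z Dz; rewrite -h// {h r}.
rewrite /koornwinder !horner_coef sp sq -/a -/b.
set t := z.2 / rho z.1; have zt := fib _ Dz; rewrite -/t in zt.
have E i : a`_i * z.1 ^+ i * rho z.1 ^+ k * (\sum_(j < k.+1) b`_j * t ^+ j) =
    \sum_(j < k.+1) a`_i * b`_j * z.1 ^+ i * rho z.1 ^+ (k - j) * z.2 ^+ j.
  rewrite big_distrr/=; apply: eq_bigr => j _.
  have -> : rho z.1 ^+ k = rho z.1 ^+ (k - j) * rho z.1 ^+ j.
    by rewrite -exprD subnK// -ltnS.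
  rewrite zt [(_ * t) ^+ _]exprMn; ring.
rewrite !big_distrl/=; under eq_bigr => i _ do rewrite E.
rewrite big_ord_recr/=.
(* The leading terms with [~~ S j] may be dropped since their coefficient is 0. *)
rewrite -addrA [X in _ + X](_ : _ = 0) ?addr0//.
apply/eqP; rewrite subr_eq0 [X in _ == X]big_mkcond/=; apply/eqP.
apply: eq_bigr => j _; case: ifPn => // Sj.
have [->|bj] := eqVneq (b`_j) 0; first by rewrite mulr0 !mul0r.
have jk : (j <= k)%N by rewrite -ltnS.
by have := qSQ _ jk bj; rewrite (negPf Sj).
Qed.

(** Writing [y = rho x * t] and expanding [t ^+ k] in the [q l] gives
    [x ^+ (n - k) * rho ^+ (k - l)] as the factor of [rho ^+ l * q l (t)].  On
    [D] this factor is a polynomial [S l] in [x], which is in turn expanded in the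
    basis [p j l]; the term of index [j] belongs to [H (j + l) l]. *)
Lemma monomial_expansion (R : realType) (D : set (R * R)) (rho : R -> R)
    (p : nat -> nat -> {poly R}) (q : nat -> {poly R}) (n k : nat)
    (T : pred nat) (U : nat -> nat) (S : nat -> {poly R}) (a : nat -> R) :
  (forall z, D z -> z.2 = rho z.1 * (z.2 / rho z.1)) ->
  (forall j l, size (p j l) = j.+1) ->
  'X^k = \sum_(0 <= l < k.+1 | T l) a l *: q l ->
  (forall l, (l <= k)%N -> T l -> (size (S l) <= (U l).+1 - l)%N) ->
  (forall l z, (l <= k)%N -> T l -> D z ->
    (S l).[z.1] = z.1 ^+ (n - k) * rho z.1 ^+ (k - l)) ->
  exists c : nat -> nat -> R, forall z, D z -> z.1 ^+ (n - k) * z.2 ^+ k =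
    \sum_(0 <= l < k.+1 | T l) \sum_(l <= m < (U l).+1)
       c m l * koornwinder rho p q m l z.
Proof.
move=> fib sp Xk sS SE.
have /choice[b bE] : forall l, exists b : nat -> R, (l <= k)%N -> T l ->
    S l = \sum_(0 <= j < (U l).+1 - l) b j *: p j l.
  move=> l; have [[lk Tl]|nlT] := pselect ((l <= k)%N /\ T l); last first.
    by exists (fun=> 0) => lk Tl; case: nlT.
  have [b h] := @poly_basis_span _ (fun j => p j l) _ _ (fun j => sp j l) (sS _ lk Tl).
  by exists b.
exists (fun m l => a l * b l (m - l)%N) => z Dz.
set t := z.2 / rho z.1; have zt := fib _ Dz; rewrite -/t in zt.
have tk : t ^+ k = \sum_(0 <= l < k.+1 | T l) a l * (q l).[t].
  rewrite -hornerXn Xk horner_sum; apply: eq_bigr => l _.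
  by rewrite hornerZ.
rewrite zt [(_ * t) ^+ _]exprMn tk !big_distrr/= big_nat_cond [RHS]big_nat_cond.
apply: eq_bigr => l /andP[/= lk Tl]; rewrite ltnS in lk.
transitivity (a l * ((S l).[z.1] * rho z.1 ^+ l * (q l).[t])).
  have -> : rho z.1 ^+ k = rho z.1 ^+ (k - l) * rho z.1 ^+ l.
    by rewrite -exprD subnK.
  by rewrite SE//; ring.
rewrite (bE _ lk Tl) horner_sum !big_distrl/= big_distrr/=.
rewrite -[X in _ = \sum_(X <= _ < _) _]add0n big_addn.
apply: eq_bigr => j _; rewrite /koornwinder addnK hornerZ -/t; ring.
Qed.

(** * Inner products of Koornwinder polynomials, and the theorem *)

Lemma rho_continuous_extension (R : realType) (alpha beta : R) (rho : R -> R)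
    (d : nat) :
  rho_polynomial alpha beta rho d \/ rho_sqrt_polynomial alpha beta rho d ->
  exists2 rhoc : R -> R, continuous rhoc & {in `[alpha, beta], rho =1 rhoc}.
Proof.
case=> -[P [_ rhoP]].
  exists (horner P); first exact: continuous_horner.
  by move=> x; rewrite in_itv/= => /rhoP.
exists (fun x => Num.sqrt P.[x]); last by move=> x; rewrite in_itv/= => /rhoP.
move=> x; apply: continuous_comp; first exact: continuous_horner.
exact: sqrt_continuous.
Qed.

Lemma continuousX (R : realType) (f : R -> R) (n : nat) :
  continuous f -> continuous (fun x => f x ^+ n).
Proof.
move=> cf x; apply: (@continuous_comp _ _ _ f (fun y => y ^+ n)).
  exact: cf.
exact: exprn_continuous.
Qed.

(** The powers [rho ^+ k] and [rho ^+ l] of the two factors and the Jacobian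
    [rho] add up to the exponent [k + l + 1]; for [k = l] this is the weight for
    which the [p n k] are orthogonal. *)
Lemma inner_koornwinder (R : realType) (alpha beta gamma delta : R)
    (w1 w2 rho rhoc : R -> R) (p : nat -> nat -> {poly R}) (q : nat -> {poly R})
    (n k m l : nat) :
  gamma < delta ->
  continuous rhoc -> {in `[alpha, beta], rho =1 rhoc} ->
  (forall x, alpha < x < beta -> 0 < rho x) ->
  lebesgue_measure.-integrable `[alpha, beta] (EFin \o w1) ->
  lebesgue_measure.-integrable `[gamma, delta] (EFin \o w2) ->
  inner (Omega alpha beta gamma delta rho) (W w1 w2 rho)
    (koornwinder rho p q n k) (koornwinder rho p q m l) =
  (\int[lebesgue_measure]_(x in `[alpha, beta])
     ((p (n - k)%N k).[x] * (p (m - l)%N l).[x] *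
      (rho x ^+ (k + l + 1) * w1 x))) *
  (\int[lebesgue_measure]_(t in `[gamma, delta])
     ((q k).[t] * (q l).[t] * w2 t)).
Proof.
move=> gd crho rhoE rho0 w1i w2i.
rewrite (@inner_fibred R alpha beta gamma delta w1 w2 rho rhoc
  (fun x => (p (n - k)%N k * p (m - l)%N l).[x] * rhoc x ^+ (k + l))
  (horner (q k * q l)))//.
- congr (_ * _); last by apply: eq_Rintegral => t _; rewrite hornerM.
  apply: eq_Rintegral => x; rewrite inE/= => xab.
  by rewrite hornerM -rhoE// addn1 exprSr; ring.
- move=> x; apply: continuousM; first exact: continuous_horner.
  exact: continuousX.
- exact: continuous_horner.
- move=> z [_ zab]; rewrite -rhoE ?in_itv//= !hornerM /koornwinder exprD; ring.
Qed.

(** The values at the endpoints may be negative, as weights are unconstrained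
    there. *)
Lemma Rintegral_itv_ge0 (R : realType) (a b : R) (f : R -> R) :
  (forall x, a < x < b -> 0 <= f x) ->
  lebesgue_measure.-integrable `[a, b] (EFin \o f) ->
  0 <= \int[lebesgue_measure]_(x in `[a, b]) f x.
Proof.
move=> f0 fi; rewrite /Rintegral -integral_itv_oo_cc//; apply: fine_ge0.
by apply: integral_ge0 => x; rewrite /= in_itv/= lee_fin => /f0.
Qed.

Theorem theorem2p2 (R : realType) (alpha beta gamma delta : R)
    (w1 w2 rho : R -> R) (p : nat -> nat -> {poly R}) (q : nat -> {poly R})
    (hab : alpha < beta) (hgd : gamma < delta)
    (hw1 : weight_on alpha beta w1) (hw2 : weight_on gamma delta w2)
    (hrho : forall x, alpha < x < beta -> 0 < rho x)
    (hcase : (exists d0, case_i alpha beta rho d0) \/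
             (exists d1, case_ii alpha beta gamma delta w2 rho d1))
    (hp : forall k, orthogonal_polynomials alpha beta
            (fun x => rho x ^+ (2 * k + 1) * w1 x) (fun n => p n k))
    (hq : orthogonal_polynomials gamma delta w2 q) :
  let Om := Omega alpha beta gamma delta rho in
  let Wt := W w1 w2 rho in
  let H := koornwinder rho p q in
  (forall n k m l : nat, (k <= n)%N -> (l <= m)%N ->
     inner Om Wt (H n k) (H m l) =
       (n == m)%:R * (k == l)%:R * norm_inner Om Wt (H n k) ^+ 2)
  /\
  (forall d0 : nat, case_i alpha beta rho d0 ->
     forall n k : nat, (k <= n)%N ->
       (exists c : nat -> R,
          lower_order Om rho n (fun l3 => (l3 <= k)%N)
            (fun z => H n k z -
               \sum_(j < k.+1)
                  c j * z.1 ^+ (n - k) * rho z.1 ^+ (k - j) * z.2 ^+ j)) /\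
       (exists c : nat -> nat -> R, forall z, Om z ->
          z.1 ^+ (n - k) * z.2 ^+ k =
            \sum_(0 <= l < k.+1) \sum_(l <= m < (upper_i d0 n k l).+1)
               c m l * H m l z))
  /\
  (forall d1 : nat, case_ii alpha beta gamma delta w2 rho d1 ->
     forall n k : nat, (k <= n)%N ->
       (~~ odd k -> exists c : nat -> R,
          lower_order Om rho n (fun l3 => ~~ odd l3 && (l3 <= k)%N)
            (fun z => H n k z -
               \sum_(j < k.+1 | ~~ odd j)
                  c j * z.1 ^+ (n - k) * rho z.1 ^+ (k - j) * z.2 ^+ j)) /\
       (odd k -> exists c : nat -> R,
          lower_order Om rho n (fun l3 => odd l3 && (1 <= l3 <= k)%N)
            (fun z => H n k z -
               \sum_(j < k.+1 | odd j)
                  c j * z.1 ^+ (n - k) * rho z.1 ^+ (k - j) * z.2 ^+ j)) /\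
       (exists c : nat -> nat -> R, forall z, Om z ->
          z.1 ^+ (n - k) * z.2 ^+ k =
            \sum_(0 <= l < k.+1 | l == k %[mod 2])
              \sum_(l <= m < (upper_ii d1 n k l).+1)
                 c m l * H m l z)).
Proof.
move=> Om Wt H.
have [w10 w1i _] := hw1; have [w20 w2i _] := hw2; have [sq oq] := hq.
have sp j l : size (p j l) = j.+1 by have [h _] := hp l; exact: h.
have fib z : Om z -> z.2 = rho z.1 * (z.2 / rho z.1) by exact: Omega_fibre.
have [rhoc crho rhoE] : exists2 rhoc : R -> R, continuous rhoc &
    {in `[alpha, beta], rho =1 rhoc}.
  case: hcase => -[d].
    by move=> h; apply: (@rho_continuous_extension _ _ _ _ d); left.
  by case=> h _ _ _; apply: (@rho_continuous_extension _ _ _ _ d); right.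
split; [|split].
- move=> n k m l kn lm.
  have HE i j i' j' : inner Om Wt (H i j) (H i' j') = _ :=
    inner_koornwinder p q i j i' j' hgd crho rhoE hrho w1i w2i.
  have [kl|kl] := eqVneq k l; last first.
    by rewrite mulr0 mul0r HE oq ?mulr0//; exact/eqP.
  rewrite -{l}kl in lm *.
  have [nm|nm] := eqVneq n m; last first.
    rewrite !mul0r HE; have [_ op] := hp k.
    by rewrite addnn -mul2n op ?mul0r//; move/eqP: nm; lia.
  (* [norm_inner] is a square root, so its square is the inner product only once
     the latter is known to be nonnegative. *)
  rewrite -nm !mul1r /norm_inner sqr_sqrtr// HE mulr_ge0//.
    apply: Rintegral_itv_ge0.
      move=> x xab; rewrite mulr_ge0 -?expr2 ?sqr_ge0// mulr_ge0 ?w10//.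
      by rewrite exprn_ge0// ltW// hrho.
    apply: (@eq_integrable _ _ _ (@lebesgue_measure R) _ _ (fun x : R =>
      ((p (n - k)%N k * p (n - k)%N k).[x] * rhoc x ^+ (k + k + 1) * w1 x)%:E)) => //.
      by move=> x; rewrite inE/= => xab; rewrite hornerM -rhoE// !mulrA.
    apply: integrable_continuousM => // x; apply: continuousM.
      exact: continuous_horner.
    exact: continuousX.
  apply: Rintegral_itv_ge0.
    by move=> x xab; rewrite mulr_ge0 ?w20// -expr2 sqr_ge0.
  apply: (@eq_integrable _ _ _ (@lebesgue_measure R) _ _ (fun x : R =>
      ((q k * q k).[x] * w2 x)%:E)) => //.
    by move=> x _; rewrite hornerM.
  exact: integrable_moment.
- move=> d0 [P [sP rhoP]] n k kn; split.
    exact: (@koornwinder_leading _ _ _ _ _ _ _ xpredT).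
  have [a aE] : exists a : nat -> R, 'X^k = \sum_(0 <= l < k.+1) a l *: q l.
    by apply: (poly_basis_span sq); rewrite size_polyXn.
  apply: (@monomial_expansion _ _ _ _ _ _ _ xpredT (upper_i d0 n k)
    (fun l => 'X^(n - k) * P ^+ (k - l)) a) => //.
    move=> l lk _; apply: leq_trans (size_monomial_pow_leq _ _ (eq_leq sP)) _.
    by rewrite /upper_i; lia.
  move=> l z lk _ [_ zab].
  by rewrite hornerM hornerXn horner_exp rhoP.
- move=> d1 [[P [sP rhoP]] dE d0 w2e] n k kn.
  have gE : gamma = - delta by rewrite dE opprK.
  have qN j : q j \Po - 'X = (-1) ^+ j *: q j.
    by apply: (@orthogonal_polynomials_parity _ delta w2); rewrite -?gE.
  have qodd j : (q k)`_j != 0 -> odd j = odd k.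
    move=> qj; apply/eqP; apply: contraNT qj => jk.
    by rewrite (parity_coef_eq0 (qN k)).
  split; [|split].
  + move=> ek; apply: (@koornwinder_leading _ _ _ _ _ _ _ (fun j => ~~ odd j)) => // j jk /qodd ->.
    by rewrite ek jk.
  + move=> ok; apply: (@koornwinder_leading _ _ _ _ _ _ _ odd) => // j jk /qodd jo.
    by rewrite jo ok jk andbT/= (odd_gt0 (etrans jo ok)).
  have [a aE] := monomial_parity_span k sq qN.
  have P0 : forall x, alpha <= x <= beta -> 0 <= P.[x].
    apply: poly_ge0_closure => // x xab.
    have := hrho _ xab; rewrite rhoP ?sqrtr_gt0//.
    by case/andP: xab => /ltW-> /ltW->.
  have ekl l : (l <= k)%N -> l == k %[mod 2] -> ~~ odd (k - l).
    by rewrite !modn2 => lk /eqP lk2; rewrite oddB//; move: lk2; case: odd; case: odd.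
  apply: (@monomial_expansion _ _ _ _ _ _ _ _ (upper_ii d1 n k)
    (fun l => 'X^(n - k) * P ^+ (k - l)./2) a) => //.
    (* The division by 2 in [upper_ii] is exact because [k - l] is even. *)
    move=> l lk lk2; apply: leq_trans (size_monomial_pow_leq _ _ (eq_leq sP)) _.
    have := ekl _ lk lk2; set e := (k - l)%N => ee.
    have he : (e * d1 %/ 2 = e./2 * d1)%N.
      by rewrite -{1}(odd_double_half e) (negPf ee) add0n -muln2 mulnAC mulnK.
    by rewrite /upper_ii -/e he; lia.
  move=> l z lk lk2 [_ zab].
  by rewrite hornerM hornerXn horner_exp rhoP// pow_sqrt_even ?P0// ekl.
Qed.
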